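(* Let $T\in\mathcal{L}(\mathcal{H})$ have closed range and let $n\ge 1$ be an integer. The following statements are equivalent: (i) $T$ is $n$-hypo-EP; (ii) $R(T^n)\subset R(T^* )$; (iii) $T^\dagger T^{n+1}T^\dagger=T^nT^\dagger$; (iv) $T^\dagger T^{n+1}+(T^\dagger T^{n+1})^*=T^n+(T^n)^*$.
   Context: $\mathcal{H}$ is a complex Hilbert space, $\mathcal{L}(\mathcal{H})$ is the algebra of bounded linear operators on $\mathcal{H}$, and $R(\cdot)$ denotes range. For $T\in\mathcal{L}(\mathcal{H})$ with closed range, the Moore-Penrose inverse $T^\dagger$ is the unique operator with $TT^\dagger T=T$, $T^\dagger TT^\dagger=T^\dagger$, $(T^\dagger T)^*=T^\dagger T$, $(TT^\dagger)^*=TT^\dagger$. A closed range operator $T$ is $n$-hypo-EP ($n$-HEP) if $R(T^n)\subseteq R(T^* )$; this is the same as being $p$-hypo-EP for $p(t)=t^n$, i.e. $T^\dagger T\,T^n=T^n\,T^\dagger T$. *)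

(* Defs.v *)
From mathcomp Require Export all_boot all_order all_algebra.
From mathcomp Require Export sesquilinear complex.
From mathcomp Require Export all_classical all_reals all_analysis.
Export Order.TTheory GRing.Theory Num.Theory.
Export numFieldNormedType.Exports.

Set Implicit Arguments.
Unset Strict Implicit.
Unset Printing Implicit Defensive.

Local Open Scope classical_set_scope.
Local Open Scope ring_scope.

(* A complex Hilbert space is a complete normed space [H] over [R[i]] with an
   inner product [dot] (linear in the first argument, conjugate-linear in the
   second, positive definite) satisfying [is_hilbert_dot dot].  Norms are valued
   in [R[i]], where they are real and nonnegative. *)
Definition is_hilbert_dot (R : realType) (H : completeNormedModType R[i])
    (dot : {dot H for (@Num.conj R[i])}) : Prop :=
  forall x : H, dot x x = `|x| ^+ 2.

Section Operators.
Variables (R : realType) (H : completeNormedModType R[i]).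
Variable dot : {dot H for (@Num.conj R[i])}.
Implicit Types (S T : H -> H) (n : nat).

Definition bounded_operator T : Prop :=
  linear T /\ exists M : R, forall x : H, `|T x| <= M%:C%C * `|x|.

(* By the Riesz representation theorem the [z] chosen here exists, and is
   unique, for every [y] when [T] is a bounded operator; 0 is only a default
   value. *)
Definition adjoint T : H -> H :=
  fun y => xget 0 [set z | forall x : H, dot (T x) y = dot x z].

Definition is_moore_penrose T S : Prop :=
  [/\ bounded_operator S,
      T \o S \o T = T,
      S \o T \o S = S,
      adjoint (S \o T) = S \o T &
      adjoint (T \o S) = T \o S].

(* A bounded operator with closed range has exactly one Moore-Penrose inverse;
   the zero operator is only a default value. *)
Definition moore_penrose T : H -> H :=
  xget (fun=> 0) [set S | is_moore_penrose T S].

(* [T] is n-hypo-EP, that is p-hypo-EP for p(t) = t^n: the orthogonal projector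
   onto the range of [adjoint T] commutes with [T^n], which is [iter n T].  For
   [T] with closed range and [n >= 1] this amounts to
   [range (iter n T) `<=` range (adjoint T)]. *)
Definition hypo_EP n T : Prop :=
  (moore_penrose T \o T) \o iter n T = iter n T \o (moore_penrose T \o T).

End Operators.

(* Main.v *)
Require Import Defs.
From mathcomp Require Import ring lra.

(** The proof has an algebraic part and an analytic part.

    Algebra.  Let [P] be the composite of [T] with its Moore-Penrose inverse
    [Td] on the left.  It is a self-adjoint idempotent with [T \o P = T], so
    that [T^n \o P = T^n] for [n >= 1], and its range is that of the adjoint of
    [T].  Each of the four statements says that [P \o T^n = T^n].  For the
    first this is [T^n \o P = T^n], for the second it is the description of
    the range of [P].  The third yields it after composition with
    [T] on the right.  For the fourth, put [A = T^n - P \o T^n]; the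
    statement says that [A + A^* = 0], where [A^* = A^* \o (1 - P)] vanishes on
    the range of [P].  Hence so does [A], and [A = A \o P = 0].

    Analysis.  The algebra rests on the defining properties of adjoints and of
    the Moore-Penrose inverse, hence on their existence.  Adjoints come from
    the Riesz representation, and this from the orthogonal projection onto
    closed subspaces ([projection], [riesz], [adjointP]).  The Moore-Penrose
    inverse maps [y] to the preimage, orthogonal to the kernel of [T], of the
    projection of [y] onto the closed range of [T].  Its boundedness is the
    only delicate point ([exists_moore_penrose]).  It follows from the uniform
    boundedness of pointwise bounded sets of vectors ([uniform_boundedness]),
    proved by a gliding hump, since the inverse has an explicit adjoint on the
    range of the adjoint of [T] ([bounded_of_dense_adjoint]), and that range is
    dense in the orthogonal complement of the kernel
    ([ortho_kernel_closure]). *)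

Set Implicit Arguments.
Unset Strict Implicit.
Unset Printing Implicit Defensive.

Local Open Scope classical_set_scope.
Local Open Scope ring_scope.

(** * Real-valued norm over the complex numbers *)

Section RealNorm.
Variable R : realType.

(** Norms of complex vectors live in the partially ordered field [R[i]]; their
    real part carries the same information in a complete ordered field, where
    infima and linear arithmetic are available. *)
Definition rnorm (V : normedZmodType R[i]) (x : V) : R := complex.Re `|x|.

Lemma rnormE (V : normedZmodType R[i]) (x : V) : (rnorm x)%:C%C = `|x|.
Proof. by rewrite /rnorm RRe_real // realE normr_ge0. Qed.

Lemma rnorm_ge0 (V : normedZmodType R[i]) (x : V) : 0 <= rnorm x.
Proof. by rewrite -lecR rnormE normr_ge0. Qed.

Lemma rnormD (V : normedZmodType R[i]) (x y : V) :
  rnorm (x + y) <= rnorm x + rnorm y.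
Proof. by rewrite -lecR rmorphD /= !rnormE ler_normD. Qed.

Lemma rnormB (V : normedZmodType R[i]) (x y : V) : rnorm (x - y) = rnorm (y - x).
Proof. by rewrite /rnorm distrC. Qed.

Lemma rnorm0 (V : normedZmodType R[i]) : rnorm (0 : V) = 0.
Proof. by rewrite /rnorm normr0. Qed.

Lemma rnorm_eq0 (V : normedZmodType R[i]) (x : V) : rnorm x = 0 -> x = 0.
Proof. by move=> x0; apply/normr0_eq0; rewrite -rnormE x0. Qed.

Lemma rnormZ (V : normedModType R[i]) (a : R[i]) (x : V) :
  rnorm (a *: x) = rnorm a * rnorm x.
Proof. by apply: complexI; rewrite rmorphM /= !rnormE normrZ. Qed.

Lemma rnormM (a b : R[i]) : rnorm (a * b) = rnorm a * rnorm b.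
Proof. by apply: complexI; rewrite rmorphM /= !rnormE normrM. Qed.

Lemma rnormC (a : R) : rnorm (a%:C%C) = `|a|.
Proof. by rewrite /rnorm normc_def /= expr0n /= addr0 sqrtr_sqr. Qed.

Lemma sqr_rnormC (z : R[i]) : (rnorm z ^+ 2)%:C%C = z * z^*.
Proof. by rewrite rmorphXn /= rnormE normCK. Qed.

Lemma conj_real (t : R) : (t%:C%C)^* = t%:C%C :> R[i].
Proof. by apply: conj_Creal; rewrite complex_real. Qed.

Lemma posC_real (e : R[i]) : 0 < e -> exists2 r : R, 0 < r & e = r%:C%C.
Proof.
move=> e0; exists (complex.Re e); last by rewrite RRe_real // realE ltW.
by move: e0; rewrite ltcE => /andP[].
Qed.

Lemma rnorm_closed (V : normedModType R[i]) (A : set V) (x : V) : closed A ->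
  (forall e : R, 0 < e -> exists2 a, A a & rnorm (x - a) < e) -> A x.
Proof.
move=> cA xA; apply: cA => B /nbhs_ballP[e /= /posC_real[r r0 ->] rB].
have [a Aa xa] := xA _ r0; exists a; split => //.
by apply: rB; rewrite -ball_normE /= -rnormE ltcR.
Qed.

Lemma rnorm_complete (V : completeNormedModType R[i]) (u : nat -> V) :
  (forall e : R, 0 < e -> exists N, forall m n,
     (N <= m)%N -> (N <= n)%N -> rnorm (u m - u n) < e) ->
  exists l, forall e : R, 0 < e -> exists N, forall n, (N <= n)%N -> rnorm (l - u n) < e.
Proof.
move=> cu; have /cvg_ex[l ul] : cvgn u.
  apply: cauchy_cvg; apply/cauchy_exP => e /posC_real[r r0 ->].
  have [N uN] := cu _ r0; exists (u N); exists N => // n /= Nn.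
  by rewrite -ball_normE /= -rnormE ltcR uN.
exists l => e e0.
have /cvgrPdist_lt/(_ (e%:C%C)) := ul.
rewrite ltcR => /(_ e0)[N _ lu]; exists N => n Nn.
by rewrite -ltcR rnormE; exact: lu.
Qed.

End RealNorm.

(** * Inner product and orthogonal projection *)

Section Dot.
Variables (R : realType) (H : completeNormedModType R[i]).
Variable dot : {dot H for (@Num.conj R[i])}.
Hypothesis dotP : is_hilbert_dot dot.
Implicit Types (x y z : H).

Lemma dotC x y : dot x y = (dot y x)^*.
Proof. by rewrite (hermC dot) /= expr0 mul1r. Qed.

Lemma dotZl a x y : dot (a *: x) y = a * dot x y.
Proof. exact: linearZl_LR. Qed.

Lemma dotZr a x y : dot x (a *: y) = a^* * dot x y.
Proof. exact: linearZr_LR. Qed.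

Lemma dotDl x y z : dot (x + y) z = dot x z + dot y z.
Proof. exact: linearDl. Qed.

Lemma dotBl x y z : dot (x - y) z = dot x z - dot y z.
Proof. exact: linearBl. Qed.

Lemma dotBr x y z : dot x (y - z) = dot x y - dot x z.
Proof. exact: linearBr. Qed.

Lemma dotDr x y z : dot x (y + z) = dot x y + dot x z.
Proof. exact: linearDr. Qed.

Lemma dot0l x : dot 0 x = 0. Proof. exact: linear0l. Qed.
Lemma dot0r x : dot x 0 = 0. Proof. exact: linear0r. Qed.

Lemma dotxx_eq0 x : dot x x = 0 -> x = 0.
Proof. by move/eqP; rewrite (dnorm_eq0 dot) => /eqP. Qed.

Lemma dot_sep x y : (forall z, dot z x = dot z y) -> x = y.
Proof.
by move=> xy; apply/subr0_eq/dotxx_eq0; rewrite dotBr xy subrr.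
Qed.

Lemma dot_eq0C x y : dot x y = 0 -> dot y x = 0.
Proof. by move=> xy; rewrite dotC xy rmorph0. Qed.

Lemma dotxx x : dot x x = ((rnorm x) ^+ 2)%:C%C.
Proof. by rewrite dotP -rnormE rmorphXn. Qed.

(** Subtracting from [x] a real multiple of its component along [y], left
    unnormalized so that [y = 0] is allowed.  The value [t = 1 / |y|^2] gives
    the Cauchy-Schwarz inequality, and a small [t > 0] the orthogonality of a
    nearest point. *)
Lemma rnorm_sqrBZ x y (t : R) :
  rnorm (x - (t%:C%C * dot x y) *: y) ^+ 2 =
  rnorm x ^+ 2 - 2 * t * rnorm (dot x y) ^+ 2
    + t ^+ 2 * rnorm (dot x y) ^+ 2 * rnorm y ^+ 2.
Proof.
apply: complexI; rewrite -dotxx (dnormB dot) /= !dotZr !dotZl !dotxx.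
have := sqr_rnormC (dot x y).
move: (rnorm x ^+ 2) (rnorm y ^+ 2) (rnorm (dot x y) ^+ 2) => a b c cE.
rewrite !(rmorphD, rmorphN, rmorphM, rmorph1) /= !(conj_real, conjCK) cE.
ring.
Qed.

Lemma parallelogram x y :
  rnorm (x + y) ^+ 2 + rnorm (x - y) ^+ 2 = 2 * (rnorm x ^+ 2 + rnorm y ^+ 2).
Proof.
have := dnormD dot x y; have := dnormB dot x y; rewrite /= !dotxx.
move: (rnorm _ ^+ 2) (rnorm _ ^+ 2) (rnorm _ ^+ 2) (rnorm _ ^+ 2) => a b c d.
move=> aE bE; apply: complexI.
rewrite !(rmorphD, rmorphM, rmorph1) /=.
by rewrite aE bE; ring.
Qed.

Lemma cauchy_schwarz x y : rnorm (dot x y) <= rnorm x * rnorm y.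
Proof.
have [->|y0] := eqVneq y 0; first by rewrite linear0r !rnorm0 mulr0.
have ny0 : 0 < rnorm y.
  by rewrite lt_def rnorm_ge0 andbT; apply: contra y0 => /eqP/rnorm_eq0 ->.
have := rnorm_sqrBZ x y ((rnorm y)^-1 ^+ 2).
set u := rnorm (_ - _) => uE; have := sqr_ge0 u; rewrite {}uE.
set b := rnorm y in ny0 *; set d := rnorm (dot x y).
have -> : rnorm x ^+ 2 - 2 * b^-1 ^+ 2 * d ^+ 2 + (b^-1 ^+ 2) ^+ 2 * d ^+ 2 * b ^+ 2
   = rnorm x ^+ 2 - (d / b) ^+ 2 by field; rewrite gt_eqF.
rewrite subr_ge0 ler_sqr ?nnegrE ?divr_ge0 ?rnorm_ge0//.
by rewrite ler_pdivrMr.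
Qed.

Definition is_subspace (M : set H) :=
  M 0 /\ forall (a : R[i]) x y, M x -> M y -> M (a *: x + y).

(** If the component of [x - m] along [y] did not vanish, moving [m] slightly
    in that direction would bring it closer to [x]. *)
Lemma nearest_ortho (M : set H) x m : is_subspace M -> M m ->
  (forall y, M y -> rnorm (x - m) <= rnorm (x - y)) ->
  forall y, M y -> dot (x - m) y = 0.
Proof.
move=> [M0 ML] Mm mmin y My; apply: rnorm_eq0; set w := x - m.
pose t := (1 + rnorm y ^+ 2)^-1.
have b0 : 0 <= rnorm y ^+ 2 by rewrite sqr_ge0.
have t0 : 0 < t by rewrite invr_gt0; lra.
have tE : t * (1 + rnorm y ^+ 2) = 1 by rewrite mulVf // gt_eqF //; lra.
have := rnorm_sqrBZ w y t.
have /mmin : M ((t%:C%C * dot w y) *: y + m) by exact: ML.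
rewrite opprD addrA addrAC => le_w uE.
have : rnorm w ^+ 2 <= rnorm (w - (t%:C%C * dot w y) *: y) ^+ 2.
  by rewrite ler_sqr ?nnegrE ?rnorm_ge0.
rewrite {}uE -/w => {le_w}.
set d := rnorm (dot w y); set b := rnorm y ^+ 2 in b0 tE * => le_d.
have d0 : 0 <= d ^+ 2 by rewrite sqr_ge0.
apply/eqP; rewrite -sqrf_eq0 eq_le d0 andbT.
suff : t * d ^+ 2 <= 0 by rewrite pmulr_rle0.
have : t ^+ 2 * d ^+ 2 * b = t * d ^+ 2 * (1 - t).
  by rewrite -{}tE; ring.
have : 0 <= t * d ^+ 2 * t by exact: mulr_ge0 (mulr_ge0 (ltW t0) d0) (ltW t0).
nra.
Qed.

(** A sequence in [M] whose distances to [x] tend to the infimum is Cauchy by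
    the parallelogram law, since the midpoint of two of its terms is itself at
    least at the infimal distance; its limit is the nearest point. *)
Theorem projection (M : set H) : is_subspace M -> closed M ->
  forall x, exists2 m, M m & forall y, M y -> dot (x - m) y = 0.
Proof.
move=> sM cM x; have [M0 ML] := sM.
pose E := [set rnorm (x - y) ^+ 2 | y in M].
have E0 : lbound E 0 by move=> _ [y _ <-]; rewrite sqr_ge0.
have hE : has_inf E by split; [exists (rnorm (x - 0) ^+ 2), 0 | exists 0].
pose d := inf E.
have dle y : M y -> d <= rnorm (x - y) ^+ 2.
  by move=> My; apply: ge_inf; [exists 0 | exists y].
have /choice[u uP] : forall k : nat, exists y, M y /\ rnorm (x - y) ^+ 2 < d + k.+1%:R^-1.
  move=> k; have [|_ [y My <-] yd] := @inf_adherent _ E k.+1%:R^-1 _ hE.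
    by rewrite invr_gt0.
  by exists y.
have inv_small (e : R) : 0 < e -> exists N : nat, forall k, (N <= k)%N -> k.+1%:R^-1 < e.
  by move=> e0; have [N _ Ne] := near_infty_natSinv_lt (PosNum e0); exists N.
have [|l ul] := @rnorm_complete _ _ u.
  move=> e e0; have [|N Ne] := inv_small (e ^+ 2 / 4).
    by rewrite divr_gt0 // exprn_gt0.
  exists N => m n Nm Nn.
  have [Mm um] := uP m; have [Mn un] := uP n.
  have := parallelogram (x - u m) (x - u n).
  have -> : x - u m - (x - u n) = u n - u m.
    by rewrite opprB addrC addrA subrK.
  have Mmid : M (2^-1 *: (u m + u n)).
    by rewrite -[_ *: _]addr0; apply: (ML) => //; rewrite -[u m]scale1r; exact: ML.
  have -> : x - u m + (x - u n) = 2 *: (x - 2^-1 *: (u m + u n)).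
    rewrite scalerBr scalerA divff ?scale1r ?pnatr_eq0 // scaler_nat mulr2n.
    by rewrite addrACA opprD.
  rewrite rnormZ.
  have -> : rnorm (2 : R[i]) = 2 by rewrite /rnorm normr_nat.
  have := dle _ Mmid; have := Ne _ Nm; have := Ne _ Nn.
  rewrite exprMn (rnormB (u n)) => h1 h2 h3 h4.
  rewrite -ltr_sqr ?nnegrE ?rnorm_ge0 // ?ltW //.
  move: un h1 um h2; move: (n.+1%:R^-1) (m.+1%:R^-1) => a b *; lra.
have Ml : M l.
  apply: rnorm_closed cM _ => e e0; have [N lu] := ul _ e0.
  by exists (u N); [case: (uP N) | exact: lu].
exists l => //; apply: nearest_ortho => // y My; rewrite leNgt; apply/negP => ylt.
pose e := rnorm (x - l) - rnorm (x - y).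
have e0 : 0 < e by rewrite subr_gt0.
have [|N1 hN1] := ul (e / 2); first by rewrite divr_gt0.
have [|N2 hN2] := inv_small (e ^+ 2 / 4); first by rewrite divr_gt0 // exprn_gt0.
pose k := maxn N1 N2.
have := hN1 k (leq_maxl _ _); rewrite rnormB => lk.
have := hN2 k (leq_maxr _ _); have := (uP k).2; have := dle _ My.
have := rnormD (x - u k) (u k - l); rewrite addrA subrK => tri.
have y0 := rnorm_ge0 (x - y).
move: (k.+1%:R^-1) => c le_d uk ce.
have xk : rnorm (x - y) + e / 2 <= rnorm (x - u k) by rewrite /e in lk *; lra.
have : (rnorm (x - y) + e / 2) ^+ 2 <= rnorm (x - u k) ^+ 2.
  by rewrite ler_sqr ?nnegrE ?rnorm_ge0 // addr_ge0 // divr_ge0 // ltW.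
have : 0 <= rnorm (x - y) * e by rewrite mulr_ge0 // ltW.
lra.
Qed.

(** * Bounded operators and their adjoints *)

Implicit Types (S T : H -> H).

Lemma linear_subr T : linear T -> forall x y, T (x - y) = T x - T y.
Proof. by move=> lT x y; have := lT (-1) y x; rewrite !scaleN1r ![- _ + _]addrC. Qed.

Lemma linear_zero T : linear T -> T 0 = 0.
Proof. by move=> lT; rewrite -[in LHS](subrr 0) linear_subr // subrr. Qed.

Lemma linear_scale T : linear T -> forall a x, T (a *: x) = a *: T x.
Proof. by move=> lT a x; rewrite -[a *: x]addr0 lT linear_zero // addr0. Qed.

Lemma bounded_operator_rnorm T : linear T ->
  (exists M : R, forall x, rnorm (T x) <= M * rnorm x) -> bounded_operator T.
Proof.
move=> lT [M bT]; split => //; exists M => x.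
by rewrite -!rnormE -rmorphM lecR.
Qed.

Lemma bounded_rnorm T : bounded_operator T ->
  exists2 M : R, 0 < M & forall x, rnorm (T x) <= M * rnorm x.
Proof.
move=> [_ [M bT]]; exists (`|M| + 1); first by rewrite ltr_wpDl.
move=> x; have := bT x; rewrite -!rnormE -rmorphM lecR => /le_trans; apply.
by rewrite ler_wpM2r ?rnorm_ge0 // ler_wpDr // ler_norm.
Qed.

Lemma bounded_comp S T : bounded_operator S -> bounded_operator T ->
  bounded_operator (S \o T).
Proof.
move=> bS bT; have [[lS _] [lT _]] := (bS, bT).
have [MS MS0 {}bS] := bounded_rnorm bS; have [MT MT0 {}bT] := bounded_rnorm bT.
apply: bounded_operator_rnorm => [a x y|]; first by rewrite /= lT lS.
exists (MS * MT) => x /=; apply: le_trans (bS _) _.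
by rewrite -mulrA ler_pM2l.
Qed.

Lemma bounded_iter T n : bounded_operator T -> bounded_operator (iter n T).
Proof.
move=> bT; elim: n => [|n IHn]; last exact: bounded_comp.
by apply: bounded_operator_rnorm => //; exists 1 => x; rewrite mul1r.
Qed.

Lemma closure_rnormP (A : set H) x :
  closure A x <-> forall e : R, 0 < e -> exists2 a, A a & rnorm (x - a) < e.
Proof.
split=> [clx e e0|xA].
  have [|a [Aa]] := clx (ball x e%:C%C); first by apply: nbhsx_ballx; rewrite ltcR.
  by rewrite -ball_normE /= -rnormE ltcR => xa; exists a.
apply: (rnorm_closed (@closed_closure _ A)) => e e0.
by have [a Aa xa] := xA _ e0; exists a => //; exact: subset_closure.
Qed.

Lemma kernel_closed T : bounded_operator T -> closed [set x | T x = 0].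
Proof.
move=> bT; have [M M0 TM] := bounded_rnorm bT; have [lT _] := bT.
move=> x /closure_rnormP xN; apply: rnorm_eq0; apply/eqP.
rewrite eq_le rnorm_ge0 andbT; apply/ler_addgt0Pr => e e0; rewrite add0r.
have [|a /= a0 xa] := xN (e / M); first exact: divr_gt0.
have := TM (x - a); rewrite linear_subr // a0 subr0 => /le_trans; apply.
by rewrite mulrC -ler_pdivlMr // ltW.
Qed.

Lemma kernel_subspace T : linear T -> is_subspace [set x | T x = 0].
Proof.
move=> lT; split => [|a x y /= x0 y0]; first exact: linear_zero.
by rewrite lT x0 y0 scaler0 addr0.
Qed.

Lemma range_subspace T : linear T -> is_subspace (range T).
Proof.
move=> lT; split => [|a _ _ [x _ <-] [y _ <-]]; first by exists 0; rewrite ?linear_zero.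
by exists (a *: x + y); rewrite ?lT.
Qed.

Lemma closure_subspace (M : set H) : is_subspace M -> is_subspace (closure M).
Proof.
move=> [M0 ML]; split=> [|a x y /closure_rnormP xM /closure_rnormP yM].
  exact: subset_closure.
apply/closure_rnormP => e e0; have na := rnorm_ge0 a.
have [|x' Mx xx] := xM (e / 2 / (rnorm a + 1)); first by rewrite !divr_gt0 // ltr_wpDl.
have [|y' My yy] := yM (e / 2); first by rewrite divr_gt0.
exists (a *: x' + y'); first exact: ML.
rewrite opprD addrACA -scalerBr; apply: le_lt_trans (rnormD _ _) _.
rewrite rnormZ [ltRHS](splitr e) ler_ltD //.
move: xx; rewrite ltr_pdivlMr ?ltr_wpDl // => /ltW; apply: le_trans.
by rewrite mulrC ler_wpM2l ?rnorm_ge0 // lerDl.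
Qed.

(** The Riesz representation of the functional [x |-> dot (T x) y]: this
    functional is determined by its kernel and its value at one vector [w]
    orthogonal to the kernel, hence is the product with a multiple of [w]. *)
Lemma riesz T y : bounded_operator T ->
  exists z, forall x, dot (T x) y = dot x z.
Proof.
move=> bT; have [lT _] := bT; have [M M0 TM] := bounded_rnorm bT.
pose K := [set x | dot (T x) y = 0].
have sK : is_subspace K.
  split => [|a u v /= u0 v0]; first by rewrite /K /= linear_zero // dot0l.
  by rewrite /K /= lT dotDl dotZl u0 v0 mulr0 addr0.
have cK : closed K.
  move=> x /closure_rnormP xK; apply: rnorm_eq0; apply/eqP.
  rewrite eq_le rnorm_ge0 andbT; apply/ler_addgt0Pr => e e0; rewrite add0r.
  have b0 : 0 < M * (rnorm y + 1) by rewrite mulr_gt0 // ltr_wpDl // rnorm_ge0.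
  have [|a /= a0 xa] := xK (e / (M * (rnorm y + 1))); first exact: divr_gt0.
  rewrite -[dot _ _]subr0 -a0 -dotBl -linear_subr //.
  apply: le_trans (cauchy_schwarz _ _) _.
  apply: (@le_trans _ _ (M * rnorm (x - a) * (rnorm y + 1))).
    by rewrite ler_pM ?rnorm_ge0 // lerDl.
  by rewrite mulrAC mulrC -ler_pdivlMr // ltW.
have [K1|] := pselect (forall x, K x); first by exists 0 => x; rewrite dot0r; exact: K1.
move=> /existsNP[x0 nK]; have [m Km mP] := projection sK cK x0.
pose w := x0 - m.
have w0 : dot w w != 0.
  by apply/eqP => /dotxx_eq0 /subr0_eq xm; apply: nK; rewrite xm.
exists ((dot (T w) y / dot w w)^* *: w) => x.
have Kx : K (dot (T x) y *: w - dot (T w) y *: x).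
  by rewrite /K /= (linear_subr lT) !(linear_scale lT) dotBl !dotZl mulrC subrr.
have := dot_eq0C (mP _ Kx); rewrite -/w dotBl !dotZl => /subr0_eq E.
by rewrite dotZr conjCK mulrAC -E mulfK.
Qed.

(** The adjoint is chosen among all solutions of its defining equation, and
    the inner product separates points. *)
Lemma adjointE T y z : (forall x, dot (T x) y = dot x z) -> adjoint dot T y = z.
Proof.
move=> Tyz; apply: xget_unique => // z' Tyz'.
by apply: dot_sep => x; rewrite -Tyz -Tyz'.
Qed.

Lemma adjointP T : bounded_operator T ->
  forall x y, dot (T x) y = dot x (adjoint dot T y).
Proof.
move=> bT x y; have [z zP] := riesz y bT.
by rewrite (adjointE zP).
Qed.

Lemma linear_adjoint T : bounded_operator T -> linear (adjoint dot T).
Proof.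
move=> bT a u v; apply: dot_sep => x.
by rewrite -adjointP // !dotDr !dotZr -!adjointP.
Qed.

End Dot.

(** * Uniform boundedness and automatic continuity *)

Section UniformBoundedness.
Variables (R : realType) (H : completeNormedModType R[i]).
Variable dot : {dot H for (@Num.conj R[i])}.
Hypothesis dotP : is_hilbert_dot dot.
Implicit Types (x y z : H) (S T : H -> H).

(** A gliding hump.  If [G] were unbounded, it would contain [g n] of norm at
    least [n * 4 ^ n].  Among two points that differ by a step of length
    [4 ^- n] along [g n], one has a product with [g n] of size at least
    [4 ^- n * |g n| / 2]; move there.  All later steps together have length at
    most [4 ^- n / 3 < 4 ^- n / 2], so the limit keeps a product with [g n] of
    size at least [n / 6], for every [n]. *)
Theorem uniform_boundedness (G : set H) :
  (forall y, exists c, forall g, G g -> rnorm (dot y g) <= c) ->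
  exists C, forall g, G g -> rnorm g <= C.
Proof.
move=> pG; apply: contrapT => nC.
pose r n : R := 4^-1 ^+ n.
have r0 n : 0 < r n by rewrite exprn_gt0.
have rS n : r n.+1 = r n / 4 by rewrite /r exprS mulrC.
have /choice[g gP] : forall n : nat, exists g, G g /\ n%:R / r n < rnorm g.
  move=> n; apply: contrapT => ng; apply: nC; exists (n%:R / r n) => h Gh.
  by rewrite leNgt; apply/negP => hn; apply: ng; exists h.
have ng0 n : 0 < rnorm (g n).
  by apply: le_lt_trans (gP n).2; rewrite divr_ge0 // ltW.
pose s n : H := ((r n / rnorm (g n))%:C)%C *: g n.
have sN n : rnorm (s n) = r n.
  by rewrite rnormZ rnormC ger0_norm ?divr_ge0 ?ltW // divfK // gt_eqF.
have sG n : rnorm (dot (s n) (g n)) = r n * rnorm (g n).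
  rewrite dotZl dotxx // rnormM !rnormC !ger0_norm ?sqr_ge0 ?divr_ge0 ?ltW //.
  by rewrite expr2 mulrA divfK // gt_eqF.
pose good n x := r n * rnorm (g n) / 2 <= rnorm (dot x (g n)).
pose x := nat_rect (fun=> H) 0 (fun n x => if good n x then x else x + s n).
have xgood n : good n (x n.+1).
  rewrite /=; case: ifPn => //; rewrite /good -ltNge => ltx.
  have := rnormD (dot (x n + s n) (g n)) (- dot (x n) (g n)).
  rewrite -dotBl addrAC subrr add0r sG /rnorm normrN -/(rnorm _) -/(rnorm _).
  lra.
have xS n : rnorm (x n - x n.+1) <= r n.
  rewrite /=; case: ifPn => _; first by rewrite subrr rnorm0 ltW.
  by rewrite rnormB addrAC subrr add0r sN.
have xD n k : rnorm (x n - x (n + k)%N) <= 4 / 3 * (r n - r (n + k)%N).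
  elim: k => [|k IHk]; first by rewrite addn0 !subrr rnorm0 mulr0.
  rewrite addnS rS; have := rnormD (x n - x (n + k)%N) (x (n + k)%N - x (n + k).+1).
  by rewrite addrA subrK; have := xS (n + k)%N; lra.
have xle m n : (m <= n)%N -> rnorm (x m - x n) <= 4 / 3 * r m.
  by move=> /subnKC <-; apply: le_trans (xD _ _) _; have := r0 (m + (n - m))%N; lra.
have rsmall (e : R) : 0 < e -> exists N, r N < e.
  move=> e0; have [N _ Ne] := near_infty_natSinv_expn_lt (PosNum e0).
  exists N; apply: le_lt_trans (Ne N (leqnn _)).
  by rewrite div1r /r exprVn lef_pV2 ?posrE ?exprn_gt0 // lerXn2r // ?nnegrE // ler_nat.
have [|l lP] := @rnorm_complete _ _ x.
  move=> e e0; have [|N Ne] := rsmall (e / 4 ); first by rewrite divr_gt0.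
  exists N => m n Nm Nn; have := rnormD (x m - x N) (x N - x n).
  by rewrite addrA subrK [rnorm (x m - x N)]rnormB; have := xle _ _ Nm; have := xle _ _ Nn; lra.
have lx n : rnorm (l - x n) <= 4 / 3 * r n.
  apply/ler_addgt0Pr => e e0; have [N Ne] := lP _ e0.
  have := Ne _ (leq_maxl N n); have := xle _ _ (leq_maxr N n).
  have := rnormD (l - x (maxn N n)) (x (maxn N n) - x n).
  by rewrite addrA subrK [rnorm (x _ - x n)]rnormB; lra.
have [c cP] := pG l.
have cn n : n%:R / 6 <= c.
  apply: le_trans (cP _ (gP n).1).
  have := xgood n; rewrite /good => h1.
  have := cauchy_schwarz dotP (l - x n.+1) (g n); rewrite dotBl => h2.
  have := rnormD (dot (x n.+1) (g n) - dot l (g n)) (dot l (g n)).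
  rewrite subrK rnormB => h3.
  have h4 : rnorm (l - x n.+1) * rnorm (g n) <= r n / 3 * rnorm (g n).
    by rewrite ler_wpM2r ?rnorm_ge0 // (le_trans (lx _)) // rS; lra.
  have := (gP n).2; rewrite ltr_pdivrMr // => h5.
  lra.
(* 6 is the inverse of 1/2 - 1/3, as computed in the bound [cn] *)
have := cn (Num.bound `|c * 6|); apply/negP; rewrite -ltNge.
rewrite ltr_pdivlMr //; apply: le_lt_trans (ler_norm _) _.
exact: archi_boundP.
Qed.

(** Automatic continuity, in the form given by the closed graph theorem.  For
    [h] in the unit ball of [D], the vectors representing
    [y |-> dot (A y) h] are pointwise bounded, by [|A y|], hence uniformly
    bounded; thus [|dot (A y) h| <= C |y| |h|] on [D], and taking [h] close to
    [A y] gives [|A y| <= C |y|]. *)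
Lemma bounded_of_dense_adjoint (A : H -> H) (D : set H) : is_subspace D ->
  (forall h, D h -> exists b, forall y, dot (A y) h = dot y b) ->
  (forall y, closure D (A y)) ->
  exists C, forall y, rnorm (A y) <= C * rnorm y.
Proof.
move=> [D0 DL] DA clD.
pose G := [set b | exists h, [/\ D h, rnorm h <= 1 & forall y, dot (A y) h = dot y b]].
have [|C0 GC0] := @uniform_boundedness G.
  move=> y; exists (rnorm (A y)) => _ [h [_ h1 <-]].
  apply: le_trans (cauchy_schwarz dotP _ _) _.
  by rewrite ler_piMr // rnorm_ge0.
pose C := `|C0|; exists C => y.
have CG b : G b -> rnorm b <= C by move=> /GC0 /le_trans; apply; exact: ler_norm.
have hC h : D h -> rnorm (dot (A y) h) <= C * rnorm y * rnorm h.
  move=> Dh; have [h0|h0] := eqVneq (rnorm h) 0.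
    by rewrite h0 (rnorm_eq0 h0) dot0r rnorm0 mulr0.
  have hp : 0 < rnorm h by rewrite lt_def h0 rnorm_ge0.
  pose h' := (((rnorm h)^-1)%:C)%C *: h.
  have Dh' : D h' by rewrite -[h']addr0; exact: DL.
  have n1 : rnorm h' = 1.
    by rewrite rnormZ rnormC ger0_norm ?invr_ge0 ?ltW // mulVf.
  have [b bP] := DA _ Dh'.
  have Cb : rnorm b <= C by apply: CG; exists h'; split => //; rewrite n1.
  have -> : h = ((rnorm h)%:C)%C *: h'.
    by rewrite scalerA -rmorphM /= divff // scale1r.
  rewrite rnormZ n1 mulr1 dotZr bP rnormM conj_real.
  rewrite rnormC ger0_norm ?rnorm_ge0 // mulrC ler_pM2r //.
  apply: le_trans (cauchy_schwarz dotP _ _) _.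
  by rewrite mulrC ler_wpM2r // rnorm_ge0.
rewrite leNgt; apply/negP => ltA.
(* with a = |A y| > c = C |y|, an h at distance less than (a - c) / 3 from A y
   yields a ^ 2 <= a * (a - c) / 3 + c * (a + (a - c) / 3) < a ^ 2 *)
have c0 : 0 <= C * rnorm y := mulr_ge0 (normr_ge0 C0) (rnorm_ge0 y).
have [|h Dh Ah] := (closure_rnormP _ _).1 (clD y) ((rnorm (A y) - C * rnorm y) / 3).
  by rewrite divr_gt0 // subr_gt0.
have := cauchy_schwarz dotP (A y) (A y - h).
have := rnormD (dot (A y) (A y - h)) (dot (A y) h).
rewrite -dotDr subrK dotxx // rnormC ger0_norm ?sqr_ge0 //.
have := hC _ Dh; have := rnormD (h - A y) (A y); rewrite subrK (rnormB h).
move: (rnorm (A y)) (C * rnorm y) c0 ltA (rnorm (A y - h)) Ah (rnorm h) => a c c0 ca e ea h' h1.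
move: (rnorm _) (rnorm _) => u v h2 h3 h4.
have : a * e <= a * ((a - c) / 3) by rewrite ler_wpM2l ?ltW // (le_lt_trans c0).
have : c * h' <= c * (a + (a - c) / 3) by rewrite ler_wpM2l //; lra.
nra.
Qed.

End UniformBoundedness.

(** * Existence of the Moore-Penrose inverse *)

Section MoorePenrose.
Variables (R : realType) (H : completeNormedModType R[i]).
Variable dot : {dot H for (@Num.conj R[i])}.
Hypothesis dotP : is_hilbert_dot dot.
Implicit Types (x y z : H) (S T : H -> H).

(** The orthogonal complement of the range of the adjoint is the kernel of
    [T], so the part of [x] orthogonal to the closure of that range is at once
    in the kernel and orthogonal to it. *)
Lemma ortho_kernel_closure T x : bounded_operator T ->
  (forall z, T z = 0 -> dot x z = 0) -> closure (range (adjoint dot T)) x.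
Proof.
move=> bT xN; have lA := linear_adjoint dotP bT.
have [m Mm mP] := projection dotP (closure_subspace (range_subspace lA))
  (@closed_closure _ _) x.
suff /subr0_eq -> : x - m = 0 by [].
have Txm : T (x - m) = 0.
  apply: (dot_sep (dot := dot)) => z; rewrite dot0r; apply: dot_eq0C.
  by rewrite (adjointP dotP bT) mP //; apply: subset_closure; exists z.
apply: (dotxx_eq0 (dot := dot)).
by rewrite {1}dotBl xN // (dot_eq0C (mP _ Mm)) subrr.
Qed.

(** [x] is the least squares solution of [T x = y] of minimal norm: [x] is
    orthogonal to the kernel of [T], and [T x] is the projection of [y] onto
    the range of [T]. *)
Definition min_least_squares T y x :=
  (forall z, T z = 0 -> dot x z = 0) /\ (forall w, dot (y - T x) (T w) = 0).

Lemma min_least_squares_exists T y : bounded_operator T -> closed (range T) ->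
  exists x, min_least_squares T y x.
Proof.
move=> bT cT; have [lT _] := bT.
have [_ [v _ <-] vP] := projection dotP (range_subspace lT) cT y.
have [n Nn nP] := projection dotP (kernel_subspace lT) (kernel_closed bT) v.
exists (v - n); split=> [z Tz|w]; first exact: nP.
by rewrite (linear_subr lT) Nn subr0; apply: vP; exists w.
Qed.

Lemma min_least_squares_unique T y x x' : linear T ->
  min_least_squares T y x -> min_least_squares T y x' -> x = x'.
Proof.
move=> lT [xN xM] [xN' xM'].
have Txx : T (x - x') = 0.
  apply: (dotxx_eq0 (dot := dot)).
  have E : T (x - x') = (y - T x') - (y - T x).
    by rewrite (linear_subr lT) opprB [RHS]addrC addrA subrK.
  by rewrite {1}E dotBl xM' xM subrr.
by apply/subr0_eq/(dotxx_eq0 (dot := dot)); rewrite dotBl xN // xN' // subrr.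
Qed.

(** The inverse maps [y] to the minimal least squares solution of [T x = y],
    which depends linearly on [y] by uniqueness.  It is bounded because it
    has a formal adjoint on the range of the adjoint of [T], which is dense in
    the orthogonal complement of the kernel of [T], where the inverse takes
    its values. *)
Lemma exists_moore_penrose T : bounded_operator T -> closed (range T) ->
  exists S, is_moore_penrose dot T S.
Proof.
move=> bT cT; have [lT _] := bT.
have [S SP] := choice (fun y => min_least_squares_exists y bT cT).
have S_N y z : T z = 0 -> dot (S y) z = 0 by case: (SP y) => + _; apply.
have S_M y w : dot (y - T (S y)) (T w) = 0 by case: (SP y).
have SE y x : min_least_squares T y x -> S y = x.
  exact: (min_least_squares_unique lT (SP y)).
have lS : linear S.
  move=> a u v; apply: SE; split=> [z Tz|w].
    by rewrite dotDl dotZl !S_N // mulr0 addr0.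
  by rewrite lT opprD addrACA -scalerBr dotDl dotZl !S_M mulr0 addr0.
have TST x : T (S (T x)) = T x.
  apply/esym/subr0_eq/(dotxx_eq0 (dot := dot)).
  by rewrite -{2}(linear_subr lT) S_M.
have TS_dot y z : dot (T (S y)) z = dot y (T (S z)).
  have /subr0_eq -> : dot y (T (S z)) - dot (T (S y)) (T (S z)) = 0.
    by rewrite -dotBl S_M.
  by apply/subr0_eq; rewrite -dotBr; apply: dot_eq0C; rewrite S_M.
have ST_dot y z : dot (S (T y)) z = dot y (S (T z)).
  apply: (@eq_trans _ _ (dot (S (T y)) (S (T z)))); apply/subr0_eq.
    by rewrite -dotBr S_N // (linear_subr lT) TST subrr.
  by rewrite -dotBl; apply: dot_eq0C; rewrite S_N // (linear_subr lT) TST subrr.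
exists S; split.
- apply: bounded_operator_rnorm => //.
  apply: (bounded_of_dense_adjoint dotP (range_subspace (linear_adjoint dotP bT))).
    move=> _ [g _ <-]; exists (T (S g)) => y.
    by rewrite -(adjointP dotP bT) TS_dot.
  by move=> y; apply: ortho_kernel_closure => // z; exact: S_N.
- by apply/funext => x; exact: TST.
- apply/funext => y; apply: SE; split=> [z|w]; first exact: S_N.
  by rewrite subrr dot0l.
- by apply/funext => y; apply: adjointE => x; exact: ST_dot.
- by apply/funext => y; apply: adjointE => x; exact: TS_dot.
Qed.

Lemma moore_penroseP T : bounded_operator T -> closed (range T) ->
  is_moore_penrose dot T (moore_penrose dot T).
Proof. by move=> bT cT; have [S SP] := exists_moore_penrose bT cT; exact: xgetI SP. Qed.

Lemma adjoint_compE S T y : bounded_operator S -> bounded_operator T ->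
  adjoint dot (S \o T) y = adjoint dot T (adjoint dot S y).
Proof. by move=> bS bT; apply: adjointE => x /=; rewrite !adjointP. Qed.

End MoorePenrose.

Unset Implicit Arguments.

(** * Characterizations of n-hypo-EP operators *)

Theorem corollary2 (R : realType) (H : completeNormedModType R[i])
    (dot : {dot H for (@Num.conj R[i])}) (dotP : is_hilbert_dot dot)
    (T : H -> H) (bT : bounded_operator T) (cT : closed (range T))
    (n : nat) (n_ge1 : (1 <= n)%N) :
  let Td := moore_penrose dot T in
  [<-> hypo_EP dot n T;
       range (iter n T) `<=` range (adjoint dot T);
       Td \o iter n.+1 T \o Td = iter n T \o Td;
       (Td \o iter n.+1 T) \+ adjoint dot (Td \o iter n.+1 T)
         = iter n T \+ adjoint dot (iter n T)].
Proof.
move=> Td; have [bTd TTdT _ adjP _] := moore_penroseP dotP bT cT.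
rewrite -/Td in bTd TTdT adjP.
pose P x := Td (T x).
have TP x : T (P x) = T x by exact: (congr1 (@^~ x) TTdT).
have bP : bounded_operator P by exact: bounded_comp bTd bT.
have PP x : P (P x) = P x by rewrite /P -/(P x) TP.
have adjPE x : adjoint dot P x = P x by exact: (congr1 (@^~ x) adjP).
have P_dot x y : dot (P x) y = dot x (P y) by rewrite (adjointP dotP bP) adjPE.
have bTn := bounded_iter n bT; have [lTn _] := bTn.
have TnP x : iter n T (P x) = iter n T x.
  by case: n n_ge1 {bTn lTn} => // m _; rewrite !iterSr TP.
have P_adj z : P (adjoint dot T z) = adjoint dot T z.
  by apply: (dot_sep (dot := dot)) => x; rewrite -P_dot -!(adjointP dotP bT) TP.
have E : Td \o iter n.+1 T = P \o iter n T by [].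
tfae.
- move=> hypo _ [x _ <-].
  have -> : iter n T x = P (iter n T x).
    by rewrite -[LHS]TnP; exact: esym (congr1 (@^~ x) hypo).
  exists (adjoint dot Td (iter n T x)) => //.
  by rewrite -adjPE -(adjoint_compE dotP).
- move=> sub; apply/funext => x.
  have [z _ zE] : range (adjoint dot T) (iter n T (Td x)) by apply: sub; exists (Td x).
  by rewrite /= -/(P _) -zE P_adj.
- move=> PTnTd; suff -> : Td \o iter n.+1 T = iter n T by [].
  apply/funext => x; rewrite E /= -TnP.
  exact: (congr1 (@^~ (T x)) PTnTd).
(* Evaluating the identity at [P x] equates the two adjoints, because the
   adjoint of [P \o iter n T] is that of [iter n T] precomposed with [P], and
   [P] is idempotent; the rest is unchanged, as [iter n T \o P = iter n T]. *)
- move=> sum; apply/funext => x /=.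
  rewrite -/(P _) -/(P _) TnP.
  have := congr1 (@^~ (P x)) sum.
  rewrite E /= (adjoint_compE dotP) // adjPE PP TnP.
  exact: addIr.
Qed.
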